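(* Let $n,p$ be integers with $1\le p\le n$ and $n\geq 3$, and let $\beta\in(0,1]$. The sectional curvature of the Stiefel manifold $\mathrm{St}_\beta(n,p)$ is bounded above by $K_\beta>0$, where $$K_\beta=\begin{cases}\frac{1}{4\beta} & 0<\beta\leq\frac16(4-\sqrt{10}),\\ \frac{4-3\beta}{2} & \frac16(4-\sqrt{10})<\beta\leq\frac23,\\ 1 & \frac23\leq\beta\leq 1.\end{cases}$$
   Context: For integers $1\le p\le n$, $\mathrm{St}(n,p)=\{U\in\mathbb{R}^{n\times p} : U^\top U=I_p\}$, with tangent spaces $T_U\mathrm{St}(n,p)=\{\Delta\in\mathbb{R}^{n\times p} : U^\top\Delta \text{ is skew-symmetric}\}$. Any $\Delta\in T_U\mathrm{St}(n,p)$ is written $\Delta=UA+U_\perp B$ with $A=U^\top\Delta$ skew-symmetric of size $p\times p$, $B\in\mathbb{R}^{(n-p)\times p}$ and $[U\ U_\perp]\in\mathrm{O}(n)$ (if $p=n$ the $B$-block is absent). For $\beta>0$, the $\beta$-metric is $\langle\Delta_1,\Delta_2\rangle_\beta=\beta\,\mathrm{tr}(A_1^\top A_2)+\mathrm{tr}(B_1^\top B_2)$, and $\mathrm{St}_\beta(n,p)$ denotes $\mathrm{St}(n,p)$ with this Riemannian metric. The bound is global: it holds for every two-dimensional tangent plane at every point. For a $\beta$-orthonormal pair $\Delta_1,\Delta_2\in T_{I_{n\times p}}\mathrm{St}_\beta(n,p)$, with $I_{n\times p}=[I_p\ 0]^\top$, the sectional curvature is given by the known formula $$\mathcal{K}_\beta(\Delta_1,\Delta_2)=\tfrac12\|B_1B_2^\top-B_2B_1^\top\|_{\mathrm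 F}^2+\tfrac{(1-2\beta)^3}{2}\|B_1^\top B_2-B_2^\top B_1\|_{\mathrm F}^2+\beta^2\|B_1A_2-B_2A_1\|_{\mathrm F}^2+\tfrac{\beta}{4}\|[A_1,A_2]-(3-4\beta)(B_1^\top B_2-B_2^\top B_1)\|_{\mathrm F}^2,$$ where $[A_1,A_2]=A_1A_2-A_2A_1$ and $\|\cdot\|_{\mathrm F}$ is the Frobenius norm; by homogeneity it suffices to consider the point $I_{n\times p}$. *)

(* Defs.v *)
From mathcomp Require Import all_boot all_order all_algebra.
From mathcomp Require Import reals.

Set Implicit Arguments.
Unset Strict Implicit.
Unset Printing Implicit Defensive.

Import Order.TTheory GRing.Theory Num.Theory.
Local Open Scope ring_scope.

Definition frobenius_norm (R : realType) (m n : nat) (M : 'M[R]_(m, n)) : R :=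
  Num.sqrt (\sum_(i < m) \sum_(j < n) M i j ^+ 2).

Definition stiefel (R : realType) (n p : nat) (U : 'M[R]_(n, p)) : Prop :=
  U^T *m U = 1%:M.

(* The square matrix [U Uperp] belongs to O(n).  Its number of columns
   p + (n - p) equals n only propositionally (for p <= n), hence the two
   separate inverse equations. *)
Definition orthogonal_completion (R : realType) (n p : nat)
    (U : 'M[R]_(n, p)) (Uperp : 'M[R]_(n, n - p)) : Prop :=
  (row_mx U Uperp)^T *m row_mx U Uperp = 1%:M /\
  row_mx U Uperp *m (row_mx U Uperp)^T = 1%:M.

Definition stiefel_tangent (R : realType) (n p : nat)
    (U D : 'M[R]_(n, p)) : Prop :=
  (U^T *m D)^T = - (U^T *m D).

(* The components A and B in D = U A + Uperp B. *)
Definition Apart (R : realType) (n p : nat) (U D : 'M[R]_(n, p)) : 'M[R]_p :=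
  U^T *m D.

Definition Bpart (R : realType) (n p : nat) (Uperp : 'M[R]_(n, n - p))
    (D : 'M[R]_(n, p)) : 'M[R]_(n - p, p) :=
  Uperp^T *m D.

Definition beta_metric (R : realType) (n p : nat) (beta : R)
    (U : 'M[R]_(n, p)) (Uperp : 'M[R]_(n, n - p)) (D1 D2 : 'M[R]_(n, p)) : R :=
  beta * \tr ((Apart U D1)^T *m Apart U D2)
  + \tr ((Bpart Uperp D1)^T *m Bpart Uperp D2).

Definition beta_orthonormal (R : realType) (n p : nat) (beta : R)
    (U : 'M[R]_(n, p)) (Uperp : 'M[R]_(n, n - p)) (D1 D2 : 'M[R]_(n, p))
    : Prop :=
  [/\ beta_metric beta U Uperp D1 D1 = 1,
      beta_metric beta U Uperp D2 D2 = 1 &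
      beta_metric beta U Uperp D1 D2 = 0].

(* The curvature formula in the blocks (A1, B1), (A2, B2) of a
   beta-orthonormal pair; here q = n - p. *)
Definition curvature_formula (R : realType) (q p : nat) (beta : R)
    (A1 A2 : 'M[R]_p) (B1 B2 : 'M[R]_(q, p)) : R :=
  2^-1 * frobenius_norm (B1 *m B2^T - B2 *m B1^T) ^+ 2
  + (1 - 2 * beta) ^+ 3 / 2 * frobenius_norm (B1^T *m B2 - B2^T *m B1) ^+ 2
  + beta ^+ 2 * frobenius_norm (B1 *m A2 - B2 *m A1) ^+ 2
  + beta / 4 * frobenius_norm
      ((A1 *m A2 - A2 *m A1)
       - (3 - 4 * beta) *: (B1^T *m B2 - B2^T *m B1)) ^+ 2.

(* Sectional curvature at U of the plane spanned by the beta-orthonormal pair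
   D1, D2.  Left multiplication by Q = [U Uperp] in O(n) is an isometry that
   maps the point [I_p 0]^T to U and the tangent vector [A; B] at that point to
   U A + Uperp B, so the formula known at [I_p 0]^T applies to the blocks of
   D1 and D2.  The value does not depend on the choice of Uperp. *)
Definition sectional_curvature (R : realType) (n p : nat) (beta : R)
    (U : 'M[R]_(n, p)) (Uperp : 'M[R]_(n, n - p)) (D1 D2 : 'M[R]_(n, p)) : R :=
  curvature_formula beta (Apart U D1) (Apart U D2)
    (Bpart Uperp D1) (Bpart Uperp D2).

Definition K_bound (R : realType) (beta : R) : R :=
  if beta <= 6^-1 * (4 - Num.sqrt 10) then 1 / (4 * beta)
  else if beta <= 2 / 3 then (4 - 3 * beta) / 2
  else 1.

(* Main.v *)
Require Import Defs.
From mathcomp Require Import all_boot all_order all_algebra.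
From mathcomp Require Import reals.
From mathcomp Require Import spectral sesquilinear complex ring lra.

(** Write A_i, B_i for the two blocks of the i-th tangent vector,
    C = B1^T B2 - B2^T B1, D = B1 B2^T - B2 B1^T, E = B1 A2 - B2 A1 and
    F = [A1, A2], and let a_i, b_i, c, d, e, f be the squared Frobenius norms.
    Expanding the last square, the curvature is
      d/2 + (2 - 3 beta)/4 c + beta^2 e + beta/4 f
        - beta (3 - 4 beta)/2 <F, C>.
    Multiplying the two normalizations beta a_i + b_i = 1 gives
      1 = beta^2 a1 a2 + beta m + b1 b2,   m = a1 b2 + a2 b1,
    so K <= M follows once the curvature is bounded by a combination of
    a1 a2, m and b1 b2 whose coefficients are at most beta^2 M, beta M and M.

    Four trace inequalities provide this:
    - f <= a1 a2 ([skew_commutator_le]), the commutator bound for skew matrices,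
      with half the constant of the Boettcher-Wenzel inequality;
    - c + d <= 4 b1 b2 ([block_commutator_le]), the same bound applied to the
      skew matrices with off-diagonal blocks B_i and -B_i^T;
    - d <= 2 b1 b2 ([skew_part_le]) and e <= m ([mixed_le]), which rest on the
      fact that the squared operator norm of a skew A is at most |A|^2 / 2.
    The first produces the coefficient 1/(4 beta) on beta^2 a1 a2; the bounds on
    c + d and on d together produce (4 - 3 beta)/2 on b1 b2.  These are the two
    competing branches of [K_bound]; the branch 1 comes from d alone, when the
    coefficient of c is negative.  The cross term <F, C> is absorbed by m for
    beta <= 3/4, as |<F, C>|^2 <= f c <= 4 a1 a2 b1 b2 <= m^2, and by f and the
    negative multiple of c for beta >= 3/4 ([curvature_scalar_le]).

    The commutator bound is spectral.  For skew real A the matrix H = i A is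
    hermitian with H^T = -H.  If the rows of the unitary P are eigenvectors of H
    with eigenvalues l_j, then the entries of P [H, B] P^T are
    (l_i + l_j) (P B P^T)_ij, and P B P^T is again skew, so only i <> j matters.
    There (l_i + l_j)^2 <= |H|^2 ([eigenvalue_pair_le]): the antisymmetry of H
    makes the opposite eigenvalues -l_i, -l_j available as well. *)

Set Implicit Arguments.
Unset Strict Implicit.
Unset Printing Implicit Defensive.
Import Order.TTheory GRing.Theory Num.Theory.
Local Open Scope ring_scope.
Local Open Scope sesquilinear_scope.

(** * The commutator bound for skew matrices over the complex numbers *)

Section HermitianNorm.
Variable C : numClosedFieldType.

Definition hnorm m n (M : 'M[C]_(m, n)) : C := \tr (M *m M^t*).

Lemma hnormE m n (M : 'M[C]_(m, n)) :
  hnorm M = \sum_i \sum_j `|M i j| ^+ 2.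
Proof.
rewrite /hnorm /mxtrace; apply: eq_bigr => i _; rewrite !mxE.
by apply: eq_bigr => j _; rewrite !mxE -normCK.
Qed.

Lemma hnorm_ge0 m n (M : 'M[C]_(m, n)) : 0 <= hnorm M.
Proof.
by rewrite hnormE; do 2!(apply: sumr_ge0 => ? _); rewrite exprn_ge0.
Qed.

Lemma trmxC_mul m n p (M : 'M[C]_(m, n)) (N : 'M[C]_(n, p)) :
  (M *m N)^t* = N^t* *m M^t*.
Proof. by rewrite trmx_mul map_mxM. Qed.

(** The transpose, not the adjoint, stands on the right: this congruence keeps
    skew matrices skew, and it preserves the norm since P^T is unitary too. *)
Lemma hnorm_congr n (P M : 'M[C]_n) :
  P \is unitarymx -> hnorm (P *m M *m P^T) = hnorm M.
Proof.
move=> PU; have PTU : P^T \is unitarymx by rewrite trmx_unitary.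
rewrite /hnorm trmxC_mul mulmxA mulmxtVK // trmxC_mul mulmxA mxtrace_mulC.
by rewrite !mulmxA (mulmx1C (unitarymxP PU)) mul1mx.
Qed.

(** Let Pi be the orthogonal projection on the row space of Q.  The antisymmetry
    of H makes the pairing of H with X = Pi - Pi^T twice the trace t of the
    compression of H, while |X|^2 <= 2 k because <Pi, Pi^T> = |Q Q^T|^2 >= 0;
    the bound is Cauchy-Schwarz between H and X. *)
Lemma compression_trace_le k n (H : 'M[C]_n) (Q : 'M[C]_(k, n)) :
    H^t* = H -> H^T = - H -> Q *m Q^t* = 1%:M -> (0 < k)%N ->
    \tr (Q *m H *m Q^t*) \is Num.real ->
  2 * \tr (Q *m H *m Q^t*) ^+ 2 <= k%:R * hnorm H.
Proof.
move=> HH HT QQ k_gt0 tR; set t := \tr _ in tR *.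
pose Pi := Q^t* *m Q; pose X := Pi - Pi^T.
have PiH : Pi^t* = Pi by rewrite trmxC_mul trmxCK.
have PiTH : Pi^T^t* = Pi^T by rewrite -[in RHS]PiH map_trmx.
have XH : X^t* = X by rewrite /X linearB /= map_mxB PiH PiTH.
have trHPi : \tr (H *m Pi) = t by rewrite mulmxA mxtrace_mulC mulmxA.
have trHX : \tr (H *m X) = 2 * t.
  rewrite mulmxBr linearB /= trHPi -(mxtrace_tr (H *m Pi^T)) trmx_mul trmxK.
  by rewrite HT mulmxN linearN /= mxtrace_mulC trHPi opprK mulr_natl mulr2n.
have trPi2 : \tr (Pi *m Pi) = k%:R.
  by rewrite mulmxA -(mulmxA _ Q) QQ mulmx1 mxtrace_mulC QQ mxtrace1.
have trPiPiT : \tr (Pi *m Pi^T) = hnorm (Q *m Q^T).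
  rewrite /hnorm trmxC_mul /Pi trmx_mul -map_trmx trmxK.
  by rewrite -!mulmxA mxtrace_mulC -!mulmxA !map_trmx trmxK.
have trX2 : \tr (X *m X) = 2 * k%:R - 2 * hnorm (Q *m Q^T).
  rewrite /X mulmxBl !mulmxBr !linearB /= (mxtrace_mulC Pi^T Pi) trPi2 trPiPiT.
  by rewrite -trmx_mul mxtrace_tr trPi2; ring.
have k0 : (k%:R : C) != 0 by rewrite pnatr_eq0 -lt0n.
(* With this c, expanding |H - c X|^2 >= 0 gives the bound. *)
pose c := t / k%:R; have cR : c^* = c.
  by apply/CrealP; rewrite realM // realV realn.
have : 0 <= hnorm (H - c *: X) by exact: hnorm_ge0.
have HcX : (H - c *: X)^t* = H - c *: X.
  by rewrite linearB /= map_mxB HH linearZ /= map_mxZ /= cR XH.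
clearbody X; rewrite /hnorm HcX HH mulmxBl !mulmxBr -!scalemxAl -!scalemxAr.
rewrite !linearB /= !linearZ /= (mxtrace_mulC X H) trHX trX2 => ge0.
have z_ge0 : 0 <= hnorm (Q *m Q^T) by exact: hnorm_ge0.
rewrite -subr_ge0.
have -> : k%:R * \tr (H *m H) - 2 * t ^+ 2 = k%:R * (\tr (H *m H) - c * (2 * t)
   - (c * (2 * t) - c * (c * (2 * k%:R - 2 * hnorm (Q *m Q^T)))))
   + k%:R * (2 * c ^+ 2 * hnorm (Q *m Q^T)).
  by rewrite /c; field.
have c2 : 0 <= c ^+ 2 by rewrite real_exprn_even_ge0 //; exact/CrealP.
by rewrite addr_ge0 // mulr_ge0 // ?ler0n // mulr_ge0 // mulr_ge0.
Qed.

(** The compression of H to the span of the eigenvectors i and j has trace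
    d_i + d_j, and k = 2 makes the constant of [compression_trace_le] equal
    to 1. *)
Lemma eigenvalue_pair_le n (H P : 'M[C]_n) (d : 'rV[C]_n) i j :
    H^t* = H -> H^T = - H -> P \is unitarymx -> d \is a realmx ->
    P *m H *m P^t* = diag_mx d -> i != j ->
  `|d 0 i + d 0 j| ^+ 2 <= hnorm H.
Proof.
move=> HH HT PU dR PHP neq_ij.
pose f (x : 'I_2) := if x == 0 then i else j.
have f_inj : injective f.
  move=> x y; rewrite /f.
  have [->|x0] := eqVneq x 0; have [->|y0] := eqVneq y 0 => //.
  - by move=> eij; rewrite eij eqxx in neq_ij.
  - by move=> eji; rewrite eji eqxx in neq_ij.
  by move: x y x0 y0 => [[|[]]//= ?] [[|[]]//= ?] _ _ _; apply: val_inj.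
pose Q : 'M[C]_(2, n) := rowsub f P.
have QM (M : 'M[C]_n) : Q *m M *m Q^t* = mxsub f f (P *m M *m P^t*).
  apply/matrixP => x y; rewrite !mxE; apply: eq_bigr => l _; rewrite !mxE.
  by congr (_ * _); apply: eq_bigr => l' _; rewrite !mxE.
have QQ : Q *m Q^t* = 1%:M.
  rewrite -[X in X *m _]mulmx1 QM mulmx1 (unitarymxP PU).
  by apply/matrixP => x y; rewrite !mxE (inj_eq f_inj).
have trQ : \tr (Q *m H *m Q^t*) = d 0 i + d 0 j.
  by rewrite QM PHP /mxtrace !big_ord_recl big_ord0 !mxE !eqxx !mulr1n addr0.
have sR : d 0 i + d 0 j \is Num.real by rewrite realD // (mxOverP dR).
have := @compression_trace_le 2 n H Q HH HT QQ isT.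
rewrite trQ => /(_ sR); rewrite ler_pM2l ?ltr0n // => le_sH.
by rewrite -normrX ger0_norm // real_exprn_even_ge0.
Qed.

(** In an eigenbasis of H the commutator multiplies the (i, j) entry of the skew
    matrix P B P^T by d_i + d_j; the diagonal, where 2 d_i could exceed |H|,
    vanishes. *)
Lemma hnorm_commutator_le n (H B : 'M[C]_n) :
    H^t* = H -> H^T = - H -> B^T = - B ->
  hnorm (H *m B - B *m H) <= hnorm H * hnorm B.
Proof.
move=> HH HT BT.
have Hherm : H \is hermsymmx.
  by apply/is_hermitianmxP; rewrite expr0 scale1r; apply/esym.
have PU := spectral_unitarymx H; set P := spectralmx H in PU.
have dR := hermitian_spectral_diag_real Hherm; set d := spectral_diag H in dR.
have /orthomx_spectralP HE := hermitian_normalmx Hherm.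
rewrite -/P -/d invmx_unitary // in HE.
have PH : P *m H = diag_mx d *m P.
  by rewrite {1}HE !mulmxA (unitarymxP PU) mul1mx.
have PHP : P *m H *m P^t* = diag_mx d by rewrite PH mulmxtVK.
have HPT : H *m P^T = - (P^T *m diag_mx d).
  have : (P *m H)^T = (diag_mx d *m P)^T by rewrite PH.
  by rewrite !trmx_mul HT tr_diag_mx mulNmx => <-; rewrite opprK.
pose B' := P *m B *m P^T.
have B'T : B'^T = - B' by rewrite !trmx_mul trmxK BT mulNmx mulmxN mulmxA.
have -> : hnorm (H *m B - B *m H) = hnorm (diag_mx d *m B' + B' *m diag_mx d).
  rewrite -(hnorm_congr _ PU) mulmxBr mulmxBl; congr hnorm.
  rewrite !mulmxA PH /B' -!mulmxA HPT !mulmxN opprK.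
  by rewrite !mulmxA.
rewrite -(hnorm_congr B PU) -/B' !hnormE mulr_sumr; apply: ler_sum => i _.
rewrite mulr_sumr; apply: ler_sum => j _.
have -> : (diag_mx d *m B' + B' *m diag_mx d) i j = (d 0 i + d 0 j) * B' i j.
  by rewrite mul_diag_mx mul_mx_diag !mxE; ring.
rewrite normrM exprMn -hnormE; have [<-|neq_ij] := eqVneq i j.
  suff -> : B' i i = 0 by rewrite normr0 expr0n !mulr0.
  have /matrixP/(_ i i) := B'T; rewrite !mxE => /eqP.
  by rewrite -addr_eq0 -mulr2n mulrn_eq0 /= => /eqP.
apply: ler_wpM2r; first by rewrite exprn_ge0.
exact: (eigenvalue_pair_le HH HT PU dR PHP neq_ij).
Qed.
End HermitianNorm.

(** * Trace inequalities for real matrices *)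

Section RealTraceInequalities.
Variable R : rcfType.

Definition ip m n (M N : 'M[R]_(m, n)) : R := \tr (M^T *m N).

Lemma ipE m n (M N : 'M[R]_(m, n)) : ip M N = \sum_i \sum_j M i j * N i j.
Proof.
rewrite exchange_big /ip /mxtrace; apply: eq_bigr => j _; rewrite !mxE.
by apply: eq_bigr => i _; rewrite !mxE.
Qed.

Lemma ip_ge0 m n (M : 'M[R]_(m, n)) : 0 <= ip M M.
Proof.
by rewrite ipE; do 2!(apply: sumr_ge0 => ? _); rewrite -expr2 sqr_ge0.
Qed.

Lemma ipC m n (M N : 'M[R]_(m, n)) : ip M N = ip N M.
Proof.
by rewrite !ipE; do 2!(apply: eq_bigr => ? _); rewrite mulrC.
Qed.

Lemma ip_tr m n (M N : 'M[R]_(m, n)) : ip M^T N^T = ip M N.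
Proof. by rewrite /ip trmxK -mxtrace_tr trmx_mul trmxK mxtrace_mulC. Qed.

Lemma ipDr m n (M N N' : 'M[R]_(m, n)) : ip M (N + N') = ip M N + ip M N'.
Proof. by rewrite /ip mulmxDr linearD. Qed.

Lemma ipNr m n (M N : 'M[R]_(m, n)) : ip M (- N) = - ip M N.
Proof. by rewrite /ip mulmxN linearN. Qed.

Lemma ipZr m n a (M N : 'M[R]_(m, n)) : ip M (a *: N) = a * ip M N.
Proof. by rewrite /ip -scalemxAr linearZ. Qed.

Lemma ip_subZ m n a (M N : 'M[R]_(m, n)) :
  ip (M - a *: N) (M - a *: N) = ip M M - 2 * a * ip M N + a ^+ 2 * ip N N.
Proof.
rewrite ipDr ipNr ipZr !(ipC (M - _)) !ipDr !ipNr !ipZr (ipC N M); ring.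
Qed.

Lemma ip_CauchySchwarz m n (M N : 'M[R]_(m, n)) :
  ip M N ^+ 2 <= ip M M * ip N N.
Proof.
have := ip_ge0 N; rewrite le0r => /orP[/eqP N0|N_gt0]; last first.
  have := ip_ge0 (M - (ip M N / ip N N) *: N); rewrite ip_subZ.
  move=> ge0; have Nn0 : ip N N != 0 by rewrite gt_eqF.
  rewrite -subr_ge0.
  have -> : ip M M * ip N N - ip M N ^+ 2 = ip N N * (ip M M
      - 2 * (ip M N / ip N N) * ip M N + (ip M N / ip N N) ^+ 2 * ip N N).
    by field.
  by rewrite mulr_ge0 // ltW.
suff -> : ip M N = 0 by rewrite N0 mulr0 expr0n.
suff -> : N = 0 by rewrite /ip mulmx0 linear0.
apply/matrixP => i j; rewrite mxE; move: N0; rewrite ipE => /eqP.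
rewrite psumr_eq0 => [/allP/(_ i (mem_index_enum _))/=|i' _]; last first.
  by apply: sumr_ge0 => j' _; rewrite -expr2 sqr_ge0.
rewrite psumr_eq0 => [/allP/(_ j (mem_index_enum _))/=|j' _]; last first.
  by rewrite -expr2 sqr_ge0.
by rewrite -expr2 sqrf_eq0 => /eqP.
Qed.

Lemma ip_rows m n (M : 'M[R]_(m, n)) : ip M M = \sum_i ip (row i M) (row i M).
Proof.
rewrite ipE; apply: eq_bigr => i _; rewrite ipE big_ord1.
by apply: eq_bigr => j _; rewrite !mxE.
Qed.

(** The factor 2 reflects that the eigenvalues of A come in pairs of opposites.
    The inequality is Cauchy-Schwarz between A and the skew matrix
    v^T w - w^T v, where w = v A. *)
Lemma skew_row_mul_le n (A : 'M[R]_n) (v : 'rV[R]_n) : A^T = - A ->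
  2 * ip (v *m A) (v *m A) <= ip v v * ip A A.
Proof.
move=> AT; set w := v *m A.
pose X := v^T *m w - w^T *m v.
have XX : ip X X = 2 * ip v v * ip w w - 2 * ip v w ^+ 2.
  have outer (a b c d : 'rV[R]_n) : ip (a^T *m b) (c^T *m d) = ip a c * ip b d.
    rewrite /ip trmx_mul trmxK mulmxA -(mulmxA b^T) [a *m c^T]mx11_scalar.
    rewrite mul_mx_scalar -scalemxAl linearZ /=; congr (_ * _).
    by rewrite -/(ip a c) ipC /ip mxtrace_mulC /mxtrace big_ord1.
  rewrite /X ipDr ipNr !(ipC (_ - _)) !ipDr !ipNr !outer (ipC w v); ring.
have AX : ip A X = 2 * ip w w.
  have vw : v *m A^T = - w by rewrite AT mulmxN.
  have e : ip A (w^T *m v) = - ip w w.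
    by rewrite /ip mulmxA mxtrace_mulC mulmxA vw mulNmx linearN /= mxtrace_mulC.
  have e' : ip A (v^T *m w) = ip w w.
    by rewrite -ip_tr trmx_mul trmxK AT ipC ipNr ipC e opprK.
  by rewrite /X ipDr ipNr e e' opprK; ring.
have := ip_CauchySchwarz A X; rewrite AX XX => CS.
have := ip_ge0 w; rewrite le0r => /orP[/eqP->|w_gt0].
  by rewrite mulr0 mulr_ge0 ?ip_ge0.
rewrite -(ler_pM2l w_gt0).
have := mulr_ge0 (ip_ge0 A) (sqr_ge0 (ip v w)).
move: CS; set a := ip A A; set b := ip v v; set c := ip w w; set d := ip v w.
by nra.
Qed.

Lemma skew_mul_le m n (B : 'M[R]_(m, n)) (A : 'M[R]_n) : A^T = - A ->
  2 * ip (B *m A) (B *m A) <= ip B B * ip A A.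
Proof.
move=> AT; rewrite ip_rows (ip_rows B) mulr_sumr mulr_suml.
by apply: ler_sum => i _; rewrite row_mul skew_row_mul_le.
Qed.

(** Pairing D with itself, |D|^2 = 2 <D B2, B1>, and D is itself skew, so
    |D B2|^2 <= |D|^2 |B2|^2 / 2 by [skew_mul_le]. *)
Lemma skew_part_le m n (B1 B2 : 'M[R]_(m, n))
    (D := B1 *m B2^T - B2 *m B1^T) :
  ip D D <= 2 * (ip B1 B1 * ip B2 B2).
Proof.
have DT : D^T = - D by rewrite /D linearB /= !trmx_mul !trmxK opprB.
have DD : ip D D = 2 * ip (D *m B2) B1.
  have e : ip D (B1 *m B2^T) = ip (D *m B2) B1.
    by rewrite /ip trmx_mul mulmxA mxtrace_mulC mulmxA.
  have e' : ip D (B2 *m B1^T) = - ip (D *m B2) B1.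
    by rewrite -e -ip_tr DT trmx_mul trmxK ipC ipNr ipC.
  by rewrite {2}/D ipDr ipNr e e'; ring.
have DB : 2 * ip (D *m B2) (D *m B2) <= ip B2 B2 * ip D D.
  rewrite -(ip_tr (D *m B2)) trmx_mul DT mulmxN ipNr ipC ipNr opprK.
  by rewrite -(ip_tr B2) skew_mul_le.
have := ip_ge0 D; rewrite le0r => /orP[/eqP->|D_gt0].
  by rewrite !mulr_ge0 ?ip_ge0.
have CS := ip_CauchySchwarz (D *m B2) B1.
have DBB := ler_wpM2r (ip_ge0 B1) DB.
rewrite -(ler_pM2l D_gt0).
apply: (@le_trans _ _ (4 * ip (D *m B2) B1 ^+ 2)); first by rewrite DD; lra.
by lra.
Qed.

(** The complex bound for H = i A, a hermitian matrix with H^T = -H. *)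
Lemma skew_commutator_le n (A B : 'M[R]_n) : A^T = - A -> B^T = - B ->
  ip (A *m B - B *m A) (A *m B - B *m A) <= ip A A * ip B B.
Proof.
move=> AT BT.
pose toC k (M : 'M[R]_k) : 'M[R[i]]_k := map_mx (real_complex R) M.
have hnormC k (M : 'M[R]_k) : hnorm (toC k M) = (ip M M)%:C%C.
  rewrite hnormE ipE rmorph_sum /=; apply: eq_bigr => i _.
  rewrite rmorph_sum /=; apply: eq_bigr => j _.
  by rewrite mxE rmorphM /= normCK; congr (_ * _); exact: conjc_real.
have conjC k (M : 'M[R]_k) : (toC k M)^t* = (toC k M)^T.
  by apply/matrixP => i j; rewrite !mxE; exact: conjc_real.
have hnormi k (M : 'M[R[i]]_k) : hnorm ('i *: M) = hnorm M.
  rewrite !hnormE; do 2!(apply: eq_bigr => ? _).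
  by rewrite mxE normrM normCi mul1r.
have skewC k (M : 'M[R]_k) : M^T = - M -> (toC k M)^T = - toC k M.
  by rewrite /toC -map_mxN => <-; rewrite map_trmx.
have HH : ('i *: toC n A)^t* = 'i *: toC n A.
  rewrite linearZ /= map_mxZ /= conjC conjCi skewC //.
  by rewrite scaleNr scalerN opprK.
have HT : ('i *: toC n A)^T = - ('i *: toC n A).
  by rewrite linearZ /= skewC // scalerN.
have BTC : (toC n B)^T = - toC n B by exact: skewC.
have := hnorm_commutator_le HH HT BTC.
rewrite -scalemxAl -scalemxAr -scalerBr !hnormi.
have -> : toC n A *m toC n B - toC n B *m toC n A = toC n (A *m B - B *m A).
  by rewrite /toC map_mxB !map_mxM.
by rewrite !hnormC -rmorphM /= lecR.
Qed.

(** The commutator of the skew matrices X B1 and X B2 is block diagonal with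
    blocks -C and -D, and |X B|^2 = 2 |B|^2. *)
Lemma block_commutator_le m n (B1 B2 : 'M[R]_(m, n))
    (C := B1^T *m B2 - B2^T *m B1) (D := B1 *m B2^T - B2 *m B1^T) :
  ip C C + ip D D <= 4 * (ip B1 B1 * ip B2 B2).
Proof.
pose X (B : 'M[R]_(m, n)) : 'M[R]_(n + m) := block_mx 0 (- B^T) B 0.
have XT B : (X B)^T = - X B.
  by rewrite /X tr_block_mx opp_block_mx !trmx0 !oppr0 linearN /= trmxK opprK.
have ip_block (M1 M2 : 'M[R]_n) N1 N2 (P1 P2 : 'M[R]_(m, n)) (Q1 Q2 : 'M[R]_m) :
    ip (block_mx M1 N1 P1 Q1) (block_mx M2 N2 P2 Q2) =
    ip M1 M2 + ip P1 P2 + (ip N1 N2 + ip Q1 Q2).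
  by rewrite /ip tr_block_mx mulmx_block mxtrace_block !linearD.
have ip0 k l : ip (0 : 'M[R]_(k, l)) 0 = 0 by rewrite /ip mulmx0 linear0.
have XX B : ip (X B) (X B) = 2 * ip B B.
  by rewrite ip_block !ip0 ipNr ipC ipNr opprK ip_tr; ring.
have := skew_commutator_le (XT B1) (XT B2); rewrite !XX.
have -> : X B1 *m X B2 - X B2 *m X B1 = block_mx (- C) 0 0 (- D).
  rewrite /X !mulmx_block !(mul0mx, mulmx0, addr0, add0r) opp_block_mx.
  rewrite add_block_mx !(mulNmx, mulmxN, opprK) !oppr0 !addr0 /C /D !opprB.
  by congr block_mx; rewrite addrC.
have ipNN k l (M : 'M[R]_(k, l)) : ip (- M) (- M) = ip M M.
  by rewrite ipNr ipC ipNr opprK.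
rewrite ip_block !ip0 !ipNN add0r addr0 => le_CD.
by apply: le_trans le_CD _; rewrite le_eqVlt; apply/orP; left; apply/eqP; ring.
Qed.

Lemma mixed_le m n (A1 A2 : 'M[R]_n) (B1 B2 : 'M[R]_(m, n))
    (E := B1 *m A2 - B2 *m A1) : A1^T = - A1 -> A2^T = - A2 ->
  ip E E <= ip A1 A1 * ip B2 B2 + ip A2 A2 * ip B1 B1.
Proof.
move=> A1T A2T.
have := skew_mul_le B1 A2T; have := skew_mul_le B2 A1T.
(* |x - y|^2 <= 2 |x|^2 + 2 |y|^2, from |x + y|^2 >= 0. *)
have := ip_ge0 (B1 *m A2 - (-1) *: (B2 *m A1)).
have -> : E = B1 *m A2 - 1 *: (B2 *m A1) by rewrite scale1r.
by rewrite !ip_subZ; lra.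
Qed.

End RealTraceInequalities.

(** * The curvature bound *)

Section Bound.
Variable R : realType.

(** The three bounds on M are the conditions under which M dominates the
    coefficients of b1 b2 and beta^2 a1 a2.  They also cover the coefficient of
    beta m.  For beta <= 3/4, where the cross term is absorbed by m, it is
    3/2 - beta, which is at most (4 - 3 beta)/2 as beta <= 1, and at most 1 for
    beta >= 1/2; for beta > 3/4 it is beta. *)
Lemma curvature_scalar_le (beta M a1 a2 b1 b2 c d e f g : R) :
    0 < beta -> beta <= 1 ->
    1 <= M -> (4 - 3 * beta) / 2 <= M -> 1 <= 4 * beta * M ->
    0 <= a1 -> 0 <= a2 -> 0 <= b1 -> 0 <= b2 ->
    0 <= c -> 0 <= f ->
    c + d <= 4 * (b1 * b2) -> d <= 2 * (b1 * b2) -> 0 <= d ->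
    e <= a1 * b2 + a2 * b1 -> f <= a1 * a2 ->
    g ^+ 2 <= f * c -> `|2 * g| <= f + c ->
    beta * a1 + b1 = 1 -> beta * a2 + b2 = 1 ->
  2^-1 * d + (1 - 2 * beta) ^+ 3 / 2 * c + beta ^+ 2 * e
  + beta / 4 * (f - 2 * (3 - 4 * beta) * g + (3 - 4 * beta) ^+ 2 * c) <= M.
Proof.
move=> b0 b1' M1 M2 M3 a10 a20 b10 b20 c0 f0
  cd d2 d0 e_le f_le g_le g_le' n1 n2.
have -> : 2^-1 * d + (1 - 2 * beta) ^+ 3 / 2 * c + beta ^+ 2 * e
  + beta / 4 * (f - 2 * (3 - 4 * beta) * g + (3 - 4 * beta) ^+ 2 * c) =
  2^-1 * d + (2 - 3 * beta) / 4 * c + beta ^+ 2 * e + beta / 4 * f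
  - beta * (3 - 4 * beta) / 2 * g by field.
pose m := a1 * b2 + a2 * b1.
have m0 : 0 <= m by rewrite addr_ge0 // mulr_ge0.
have aa0 : 0 <= a1 * a2 by rewrite mulr_ge0.
have bb0 : 0 <= b1 * b2 by rewrite mulr_ge0.
have gm : - g <= m.
  have : g ^+ 2 <= m ^+ 2.
    apply: le_trans g_le _; apply: (@le_trans _ _ (a1 * a2 * (4 * (b1 * b2)))).
      by apply: ler_pM => //; lra.
    by have := sqr_ge0 (a1 * b2 - a2 * b1); rewrite /m; nra.
  rewrite -ler_sqrt ?sqr_ge0 // !sqrtr_sqr (ger0_norm m0) ler_norml.
  by move=> /andP[]; lra.
(* The product of the two normalizations, times M. *)
have one : M = M * (beta ^+ 2 * (a1 * a2)) + M * (beta * m) + M * (b1 * b2).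
  rewrite -[LHS]mulr1 -[X in _ * X]mulr1 -{1}n1 -n2 /m; ring.
have e' : beta ^+ 2 * e <= beta ^+ 2 * m by rewrite ler_wpM2l // sqr_ge0.
have bm0 : 0 <= beta * m by rewrite mulr_ge0 // ltW.
have T1 : beta / 4 * (a1 * a2) <= M * (beta ^+ 2 * (a1 * a2)).
  have coef : beta / 4 <= M * beta ^+ 2 by nra.
  by have := ler_wpM2r aa0 coef; lra.
rewrite one.
have [le34|gt34] := leP beta (3 / 4).
  have T2 : beta / 4 * f <= beta / 4 * (a1 * a2) by rewrite ler_wpM2l //; lra.
  have T3 : - (beta * (3 - 4 * beta) / 2 * g) <= beta * (3 - 4 * beta) / 2 * m.
    by rewrite -mulrN ler_wpM2l // divr_ge0 // mulr_ge0; lra.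
  have T4 : (3 / 2 - beta) * (beta * m) <= M * (beta * m).
    by rewrite ler_wpM2r //; lra.
  have T5 : 2^-1 * d + (2 - 3 * beta) / 4 * c <= M * (b1 * b2).
    (* For beta <= 2/3 the left side is
       (2 - 3 beta)/4 (c + d) + 3 beta/4 d. *)
    have [le23|gt23] := leP beta (2 / 3).
      apply: (@le_trans _ _ ((4 - 3 * beta) / 2 * (b1 * b2))); first by nra.
      by rewrite ler_wpM2r.
    by apply: (@le_trans _ _ (1 * (b1 * b2))); [nra | rewrite ler_wpM2r].
  by move: T1 T2 T3 T4 T5 e'; nra.
have T2 : 2^-1 * d <= M * (b1 * b2) by nra.
have T3 :
  - (beta * (3 - 4 * beta) / 2 * g) <= beta * (4 * beta - 3) / 4 * (f + c).
  move: g_le'; rewrite ler_norml => /andP[_ ?].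
  have : 0 <= beta * (4 * beta - 3) / 4 by rewrite divr_ge0 // mulr_ge0; lra.
  by nra.
have T4 : (2 - 3 * beta) / 4 * c + beta * (4 * beta - 3) / 4 * c <= 0.
  (* This coefficient is (2 beta - 1) (beta - 1) / 2. *)
  have : (2 - 3 * beta) / 4 + beta * (4 * beta - 3) / 4 <= 0 by nra.
  by nra.
have T5 :
  beta / 4 * f + beta * (4 * beta - 3) / 4 * f <= M * (beta ^+ 2 * (a1 * a2)).
  apply: (@le_trans _ _ (beta ^+ 2 * (a1 * a2))); last first.
    by rewrite -[X in X <= _]mul1r ler_wpM2r // mulr_ge0 ?sqr_ge0.
  apply: (@le_trans _ _ (beta ^+ 2 * f)); last by rewrite ler_wpM2l ?sqr_ge0.
  by nra.
have T6 : beta ^+ 2 * m <= M * (beta * m).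
  by rewrite expr2 -mulrA ler_wpM2r //; lra.
by lra.
Qed.

(** [K_bound] is the maximum of 1, (4 - 3 beta)/2 and 1/(4 beta): the last two
    agree where (4 - 6 beta)^2 = 10, whose only root in (0, 1] is the first
    threshold. *)
Lemma K_bound_ge (beta : R) : 0 < beta -> beta <= 1 ->
  [/\ 1 <= K_bound beta, (4 - 3 * beta) / 2 <= K_bound beta
    & 1 <= 4 * beta * K_bound beta].
Proof.
move=> b0 b1; rewrite /K_bound.
have s2 : Num.sqrt (10 : R) ^+ 2 = 10 by rewrite sqr_sqrtr ?ler0n.
have s0 : 0 <= Num.sqrt (10 : R) by rewrite sqrtr_ge0.
set s := Num.sqrt 10 in s2 s0 *.
case: ifP => [le_b|/negbT]; last rewrite -ltNge => gt_b.
  have bq : (4 - 3 * beta) / 2 <= 1 / (4 * beta).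
    rewrite ler_pdivlMr ?mulr_gt0 //.
    have : s <= 4 - 6 * beta by lra.
    by nra.
  by split=> //; [lra | rewrite mul1r mulfV // mulf_neq0 // gt_eqF].
have [le23|gt23] := leP beta (2 / 3); split; try lra.
have : 4 - 6 * beta < s by lra.
by nra.
Qed.

Lemma frobenius_normE m n (M : 'M[R]_(m, n)) : frobenius_norm M ^+ 2 = ip M M.
Proof.
rewrite /frobenius_norm sqr_sqrtr.
  by rewrite ipE; do 2!(apply: eq_bigr => ? _); rewrite expr2.
by do 2!(apply: sumr_ge0 => ? _); rewrite sqr_ge0.
Qed.

Lemma curvature_formula_le q p (beta : R) (A1 A2 : 'M[R]_p)
    (B1 B2 : 'M[R]_(q, p)) :
    0 < beta -> beta <= 1 -> A1^T = - A1 -> A2^T = - A2 ->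
    beta * ip A1 A1 + ip B1 B1 = 1 -> beta * ip A2 A2 + ip B2 B2 = 1 ->
  curvature_formula beta A1 A2 B1 B2 <= K_bound beta.
Proof.
move=> b0 b1 A1T A2T n1 n2; have [M1 M2 M3] := K_bound_ge b0 b1.
rewrite /curvature_formula !frobenius_normE ip_subZ.
set D := _ - B2 *m _; set C := _ - B2^T *m _; set E := _ - B2 *m A1.
set F := _ - A2 *m A1.
have CS := ip_CauchySchwarz F C.
apply: (@curvature_scalar_le beta _ (ip A1 A1) (ip A2 A2)
  (ip B1 B1) (ip B2 B2)); rewrite ?ip_ge0 //.
- exact: block_commutator_le.
- exact: skew_part_le.
- exact: mixed_le.
- exact: skew_commutator_le.
- have := ip_ge0 (F - 1 *: C); have := ip_ge0 (F - (-1) *: C).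
  by rewrite !ip_subZ ler_norml => *; apply/andP; split; lra.
Qed.
End Bound.

Theorem theorem6p1 (R : realType) (n p : nat) (beta : R)
  (hp : (1 <= p)%N) (hpn : (p <= n)%N) (hn : (3 <= n)%N)
  (hbeta0 : 0 < beta) (hbeta1 : beta <= 1) :
  0 < K_bound beta /\
  forall (U : 'M[R]_(n, p)) (Uperp : 'M[R]_(n, n - p)) (D1 D2 : 'M[R]_(n, p)),
    stiefel U -> orthogonal_completion U Uperp ->
    stiefel_tangent U D1 -> stiefel_tangent U D2 ->
    beta_orthonormal beta U Uperp D1 D2 ->
    sectional_curvature beta U Uperp D1 D2 <= K_bound beta.
Proof.
split.
  by have [K1 _ _] := K_bound_ge hbeta0 hbeta1; exact: lt_le_trans K1.
move=> U Uperp D1 D2 _ _ T1 T2 [n1 n2 _].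
exact: curvature_formula_le.
Qed.
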